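(* Let $\mathbf C\in\mathbb R^{K\times R}$, $2\le K\le R$, $m=R-K+2$, and $k_{\mathbf C}\ge K-1$. Let $\mathcal R_m(\mathbf C)^T\upharpoonright_{\mathrm{range}(\pi_S)}$ denote the restriction of the mapping $\mathcal R_m(\mathbf C)^T:\mathbb R^{K^m}\to\mathbb R^{\binom Rm}$ to $\mathrm{range}(\pi_S)$. Then (i) the matrix $\mathcal R_m(\mathbf C)$ has full column rank; hence $\dim\mathrm{range}(\mathcal R_m(\mathbf C)^T)=\binom Rm$; (ii) $\dim\ker\left(\mathcal R_m(\mathbf C)^T\upharpoonright_{\mathrm{range}(\pi_S)}\right)=\binom{R}{K-1}$; (iii) if $k_{\mathbf C}=K$, then $\ker\left(\mathcal R_m(\mathbf C)^T\upharpoonright_{\mathrm{range}(\pi_S)}\right)=\mathrm{range}\left(\mathcal B(\mathbf C)^{(m)}\right)$.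
   Context: $k_{\mathbf M}$ (the $k$-rank of a matrix $\mathbf M$) is the largest number such that every subset of $k_{\mathbf M}$ columns of $\mathbf M$ is linearly independent. $\mathrm{perm}$ denotes the permanent. $S^m_R$ is the set of tuples $(i_1,\dots,i_m)$ with $1\le i_1<\dots<i_m\le R$, and $R^m_K=\{1,\dots,K\}^m$, both ordered lexicographically. $\mathbf C((i_1,\dots,i_m),(j_1,\dots,j_m))$ is the $m\times m$ matrix whose $(p,q)$ entry is $c_{i_pj_q}$ (row indices may repeat). $\mathcal R_m(\mathbf C)$ is the $K^m\times\binom Rm$ matrix, with rows indexed by $R^m_K$ and columns by $S^m_R$, whose $(i,j)$ entry is $\mathrm{perm}\,\mathbf C(i,j)$. The symmetrizer $\pi_S:\mathbb R^{K^m}\to\mathbb R^{K^m}$ is the linear map with $\pi_S(\mathbf t_1\otimes\dots\otimes\mathbf t_m)=\frac1{m!}\sum_{(l_1,\dots,l_m)}\mathbf t_{l_1}\otimes\dots\otimes\mathbf t_{l_m}$ for $\mathbf t_1,\dots,\mathbf t_m\in\mathbb R^K$, the sum being over all permutations of $\{1,\dots,m\}$. The $k$-th compound matrix $\mathcal C_k(\mathbf M)$ of $\mathbf M\in\mathbb R^{p\times q}$ ($k\le\min(p,q)$) is the $\binom pk\times\binom qk$ matrix of all $k\times k$ minors, with row and column index sets in lexicographic order. $\mathcal B(\mathbf C):=\mathbf L\,\mathcal C_{K-1}(\mathbf C)\in\mathbb R^{K\times\binom{R}{K-1}}$, where $\mathbf L\in\mathbb R^{K\times K}$ has entries $\mathbf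 L_{K+1-j,\,j}=(-1)^{j-1}$, $1\le j\le K$, and zeros elsewhere. $\mathcal B(\mathbf C)^{(m)}=\mathcal B(\mathbf C)\odot\dots\odot\mathcal B(\mathbf C)$ ($m$ factors), where $\odot$ is the Khatri-Rao (column-wise Kronecker) product. *)

(* Defs.v *)
From HB Require Import structures.
From mathcomp Require Import all_boot all_order all_algebra all_fingroup.
From mathcomp Require Import reals mxtens.

Set Implicit Arguments.
Unset Strict Implicit.
Unset Printing Implicit Defensive.

Import Order.TTheory GRing.Theory Num.Theory.
Local Open Scope ring_scope.

(* The r-th element (0-based) of {1..K}^m in lexicographic order.  The         *)
(* recursion peels off the leading digit with the index convention of the      *)
(* Kronecker product tensmx.                                                   *)
Fixpoint multiidx (K m : nat) : 'I_(K ^ m) -> m.-tuple 'I_K :=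
  match m with
  | 0 => fun _ => [tuple]
  | m'.+1 => fun r =>
      let ij := mxtens_unindex (cast_ord (expnS K m') r) in
      [tuple of ij.1 :: multiidx ij.2]
  end.

Definition incr_tuples (m R : nat) : {set m.-tuplelexi 'I_R} :=
  [set t : m.-tuplelexi 'I_R | sorted ltn (map val t)].

Lemma card_incr_tuples (m R : nat) : #|incr_tuples m R| = 'C(R, m).
Proof. exact: card_ltn_sorted_tuples. Qed.

(* The j-th strictly increasing m-tuple in lexicographic order; Order.enum_val *)
(* follows the order of the type, which is lexicographic on m.-tuplelexi.       *)
Definition incridx (R m : nat) (j : 'I_('C(R, m))) : m.-tuple 'I_R :=
  Order.enum_val (cast_ord (esym (card_incr_tuples m R)) j).

Definition permanent (S : comNzRingType) (n : nat) (A : 'M[S]_n) : S :=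
  \sum_(s : 'S_n) \prod_(i < n) A i (s i).

Definition calR (S : comNzRingType) (m K R : nat) (C : 'M[S]_(K, R)) :
    'M[S]_(K ^ m, 'C(R, m)) :=
  \matrix_(r, j) permanent (mxsub (tnth (multiidx r)) (tnth (incridx j)) C).

Definition compound (S : comNzRingType) (k p q : nat) (M : 'M[S]_(p, q)) :
    'M[S]_('C(p, k), 'C(q, k)) :=
  \matrix_(i, j) \det (mxsub (tnth (incridx i)) (tnth (incridx j)) M).

(* For 0 < K this is a K x K matrix, since 'C(K, K.-1) = K; stating its width  *)
(* as 'C(K, K.-1) avoids a cast in calB.  With 0-based indices, the 1-based    *)
(* entry (K + 1 - j, j) is the entry (K - 1 - j, j).                           *)
Definition antidiagL (S : comNzRingType) (K : nat) : 'M[S]_(K, 'C(K, K.-1)) :=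
  \matrix_(i, j) (if (i + j == K.-1)%N then (-1) ^+ j else 0).

Definition calB (S : comNzRingType) (K R : nat) (C : 'M[S]_(K, R)) :
    'M[S]_(K, 'C(R, K.-1)) :=
  antidiagL S K *m compound K.-1 C.

Definition khatri_rao (S : comNzRingType) (p q n : nat)
    (A : 'M[S]_(p, n)) (B : 'M[S]_(q, n)) : 'M[S]_(p * q, n) :=
  \matrix_(i, j) (A (mxtens_unindex i).1 j * B (mxtens_unindex i).2 j).

Lemma col_khatri_rao (S : comNzRingType) (p q n : nat)
    (A : 'M[S]_(p, n)) (B : 'M[S]_(q, n)) (j : 'I_n) :
  col j (khatri_rao A B) = col j A *t col j B.
Proof. by apply/matrixP => i k; rewrite !mxE. Qed.

(* B_0 (.) B_1 (.) ... (.) B_(m-1).  The empty product is the row of ones.     *)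
(* For n = 1 this is the Kronecker product t_1 (x) ... (x) t_m of vectors.     *)
Fixpoint khatri_rao_prod (S : comNzRingType) (K n m : nat) :
    ('I_m -> 'M[S]_(K, n)) -> 'M[S]_(K ^ m, n) :=
  match m with
  | 0 => fun _ => const_mx 1
  | m'.+1 => fun B =>
      castmx (esym (expnS K m'), erefl n)
        (khatri_rao (B ord0) (khatri_rao_prod (fun p => B (lift ord0 p))))
  end.

Definition khatri_rao_exp (S : comNzRingType) (K n m : nat)
    (B : 'M[S]_(K, n)) : 'M[S]_(K ^ m, n) :=
  khatri_rao_prod (fun _ : 'I_m => B).

(* The bound k <= q is needed: for k > q there is no set of k columns. *)
Definition krank (F : fieldType) (p q : nat) (M : 'M[F]_(p, q)) : nat :=
  \max_(k < q.+1 | [forall J : {set 'I_q}, (#|J| == k) ==>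
                      free [seq col j M | j <- enum J]]) k.

Definition mxfun (F : fieldType) (p q : nat) (A : 'M[F]_(p, q)) :
    'Hom('cV[F]_q, 'cV[F]_p) := linfun (mulmx A).

Definition mxrange (F : fieldType) (p q : nat) (A : 'M[F]_(p, q)) :
    {vspace 'cV[F]_p} := limg (mxfun A).

(* The matrix of pi_S: its s-th column is the image of the basis tensor        *)
(* e_(s_1) (x) ... (x) e_(s_m).                                                *)
Definition symmetrizer_mx (F : fieldType) (K m : nat) : 'M[F]_(K ^ m) :=
  \matrix_(r, s) ((m`!)%:R^-1 * \sum_(l : 'S_m)
    (multiidx r == [tuple tnth (multiidx s) (l p) | p < m])%:R).

Definition symmetrizer (F : fieldType) (K m : nat) :
    'Hom('cV[F]_(K ^ m), 'cV[F]_(K ^ m)) := mxfun (symmetrizer_mx F K m).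

(* The kernel of the restriction of f to U is viewed inside aT, not subvs_of U. *)
Definition lker_restr (F : fieldType) (aT rT : vectType F)
    (f : 'Hom(aT, rT)) (U : {vspace aT}) : {vspace aT} := (U :&: lker f)%VS.

Lemma mxfunE (F : fieldType) (p q : nat) (A : 'M[F]_(p, q)) v :
  mxfun A v = A *m v.
Proof. by rewrite lfunE. Qed.

Lemma multiidx_inj (K m : nat) : injective (@multiidx K m).
Proof.
elim: m => [|m IHm] r s.
  by move=> _; apply: val_inj; case: r s => [[|r] ?] [[|s] ?].
move=> /(congr1 val) [e1 /val_inj/IHm e3].
apply: (can_inj (cast_ordK (expnS K m))).
apply: (can_inj (@mxtens_unindexK K (K ^ m))).
have eq_pair (u v : 'I_K * 'I_(K ^ m)) : u.1 = v.1 -> u.2 = v.2 -> u = v.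
  by case: u v => [? ?] [? ?] /= -> ->.
by apply: eq_pair => //; apply: val_inj.
Qed.

Lemma multiidx_bij (K m : nat) : bijective (@multiidx K m).
Proof.
by apply: inj_card_bij (@multiidx_inj K m) _; rewrite card_tuple !card_ord.
Qed.

Lemma multiidx_lexi (K m : nat) :
  {mono (fun r => multiidx r : m.-tuplelexi 'I_K) :
     r s / (r <= s)%N >-> (r <= s)%O}.
Proof.
suff lt_midx (r s : 'I_(K ^ m)) : (r < s)%N ->
    ((multiidx r : m.-tuplelexi 'I_K) < (multiidx s : m.-tuplelexi 'I_K))%O.
  move=> r s; case: ltngtP => [/lt_midx/ltW -> //|/lt_midx|/val_inj ->].
    by rewrite ltNge => /negbTE.
  by rewrite lexx.
have ltE n (t u : n.-tuplelexi 'I_K) :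
    (t < u)%O = ((tval t : seqlexi 'I_K) < (tval u : seqlexi 'I_K))%O by [].
elim: m r s => [|m IHm] r s; first by case: r s => [[|r] ?] [[|s] ?].
set r' := cast_ord (expnS K m) r; set s' := cast_ord (expnS K m) s.
rewrite -[nat_of_ord r]/(nat_of_ord r') -[nat_of_ord s]/(nat_of_ord s').
rewrite (divn_eq r' (K ^ m)) (divn_eq s' (K ^ m)) => lt_rs.
have Km0 : (0 < K ^ m)%N by case: (K ^ m)%N r' {s' lt_rs} => // -[]; rewrite muln0.
have lt_mod (x : 'I_(K * K ^ m)) : (x %% K ^ m < K ^ m)%N by rewrite ltn_mod.
rewrite ltE /= ltxi_cons -/r' -/s'.
case: (ltngtP (r' %/ K ^ m) (s' %/ K ^ m))%N => [lt_d|lt_d|eq_d].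
- by rewrite !leEord /= ltnW //= leqNgt lt_d.
- move: lt_rs; rewrite ltnNge => /negP[].
  apply: leq_trans (_ : _ <= (s' %/ K ^ m).+1 * K ^ m)%N _.
    by rewrite mulSn addnC leq_add2r ltnW.
  by rewrite (leq_trans _ (leq_addr _ _)) // leq_mul2r lt_d orbT.
rewrite !leEord /= eq_d leqnn /=.
rewrite -[X in is_true X]ltE; apply: IHm.
by move: lt_rs; rewrite eq_d ltn_add2l.
Qed.

Lemma khatri_rao_prodE (S : comNzRingType) (K n m : nat)
    (B : 'I_m -> 'M[S]_(K, n)) r j :
  khatri_rao_prod B r j = \prod_(p < m) B p (tnth (multiidx r) p) j.
Proof.
elim: m B r => [|m IHm] B r; first by rewrite big_ord0 mxE.
rewrite big_ord_recl castmxE mxE esymK cast_ord_id IHm /= tnth0.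
by congr (_ * _); apply: eq_bigr => p _; rewrite tnthS.
Qed.

Lemma symmetrizer_khatri_rao_prod (F : fieldType) (K m : nat)
    (t : 'I_m -> 'cV[F]_K) :
  symmetrizer F K m (khatri_rao_prod t) =
  (m`!)%:R^-1 *: \sum_(l : 'S_m) khatri_rao_prod (fun p => t (l p)).
Proof.
rewrite mxfunE; apply/matrixP => r j; rewrite !mxE summxE.
under eq_bigr => s _ do rewrite mxE -mulrA mulr_suml.
rewrite -mulr_sumr exchange_big /=; congr (_ * _).
apply: eq_bigr => l _; rewrite khatri_rao_prodE.
have [f _ fK] := multiidx_bij K m.
pose s0 := f [tuple tnth (multiidx r) ((l^-1)%g p) | p < m].
have s0l p : tnth (multiidx s0) (l p) = tnth (multiidx r) p.
  by rewrite fK tnth_mktuple permK.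
rewrite (bigD1 s0) //= big1 ?addr0 => [|s /negP sNs0].
  rewrite khatri_rao_prodE (reindex_perm l) /=.
  under eq_bigr => p _ do rewrite s0l.
  suff -> : multiidx r = [tuple tnth (multiidx s0) (l p) | p < m].
    by rewrite eqxx mul1r.
  by apply: eq_from_tnth => p; rewrite tnth_mktuple s0l.
case: eqP => [rE|]; last by rewrite mul0r.
case: sNs0; apply/eqP/(@multiidx_inj K m)/eq_from_tnth => p.
by rewrite -[p](permKV l) s0l rE tnth_mktuple.
Qed.

(* Main.v *)
Require Import Defs.
From mathcomp Require Import all_boot all_order all_algebra all_fingroup.
From mathcomp Require Import reals.

(** Read a symmetric tensor in the m-th power of F^K as a form of degree m in
K variables.  A column of [calR m C] is, up to the factor m!, the product of
the linear forms attached to m distinct columns of C, and contracting it with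
the power x^(tensor m) evaluates that product at x
([mul_khatri_rao_exp_calR]).  Everything rests on evaluating such products at
well-chosen points; both independence statements say that an evaluation matrix
is diagonal with nonzero diagonal ([mxrank_diag_test]).

(i) The complement of an m-set J of columns has K - 2 elements.  Since any
K - 1 columns are independent, there is a point x orthogonal to exactly the
columns outside J ([exists_annihilator]).  The product attached to J does not
vanish at x, whereas any other product has a factor outside J and does.

(ii) The transpose of [calR m C] is unchanged by symmetrization, so its
restriction to symmetric tensors keeps the rank 'C(R, m) of (i).  Symmetric
tensors have the dimension 'C(R + 1, m) of the forms of degree m
([mxrank_symmetrizer], as m + K - 1 = R + 1), and Pascal's rule leaves
'C(R, m - 1) = 'C(R, K - 1) for the kernel.

(iii) The column of [calB C] attached to a (K - 1)-set J is the generalized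
cross product of the columns in J: its inner product with c_i is the
determinant of (C_J, c_i) ([mul_calB]).  So it is orthogonal to c_i when i is
in J and, if any K columns are independent, only then.  An m-set and a
(K - 1)-set of indices always meet, as m + K - 1 > R, which puts the powers of
these vectors into the kernel ([khatri_rao_exp_calB_calR]).  They are
independent because the product of the forms outside J vanishes at all of them
but one ([mxrank_khatri_rao_exp_calB]), and there are 'C(R, K - 1) of them, as
many as the dimension found in (ii). *)

Set Implicit Arguments.
Unset Strict Implicit.
Unset Printing Implicit Defensive.

Import Order.TTheory GRing.Theory Num.Theory.
Local Open Scope ring_scope.

(** * Ranks of matrices and dimensions of ranges *)

Lemma fact_neq0 (F : numDomainType) (m : nat) : (m`!)%:R != 0 :> F.
Proof. by rewrite pnatr_eq0 -lt0n fact_gt0. Qed.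

(** The rows of D are functionals dual, up to nonzero scalars, to the columns of A,
which are therefore independent. *)
Lemma mxrank_diag_test (F : fieldType) (p n : nat) (D : 'M[F]_(n, p))
    (A : 'M[F]_(p, n)) :
  is_diag_mx (D *m A) -> (forall j, (D *m A) j j != 0) -> \rank A = n.
Proof.
move=> diagDA DA0; apply/eqP; rewrite eqn_leq rank_leq_col /=.
apply: leq_trans (mxrankM_maxr D A).
have /mxrank_unit -> // : D *m A \in unitmx.
rewrite unitmxE det_trig ?unitfE ?is_diag_mx_is_trig //.
by apply/prodf_neq0 => j _; apply: DA0.
Qed.

(** A rank factorization of A splits its map into a surjection onto column
vectors of size [\rank A] followed by an injection. *)
Lemma dim_mxrange (F : fieldType) (p q : nat) (A : 'M[F]_(p, q)) :
  \dim (mxrange A) = \rank A.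
Proof.
rewrite /mxrange.
have -> : mxfun A = (mxfun (col_base A) \o mxfun (row_base A))%VF.
  apply/lfunP => v; rewrite comp_lfunE !mxfunE mulmxA mulmx_base //.
rewrite limg_comp limg_dim_eq.
  suff -> : limg (mxfun (row_base A)) = fullv.
    by rewrite dimvf /dim /= muln1.
  apply/vspaceP => v; rewrite memvf; apply/memv_imgP.
  have /row_freeP[B AB] := row_base_free A.
  by exists (B *m v); rewrite ?memvf // mxfunE mulmxA AB mul1mx.
apply/eqP; rewrite -subv0; apply/subvP => v.
rewrite memv_cap memv0 memv_ker mxfunE => /andP[_ /eqP Av0]; apply/eqP.
by apply: (row_full_inj (col_base_full A)); rewrite Av0 mulmx0.
Qed.

(** * Contraction of pure tensors *)

(** The map from r to the function of its digits is a bijection onto all functions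
from ['I_m] to ['I_K], so this is generalized distributivity. *)
Lemma sum_multiidx (S : comNzRingType) (K m : nat) (G : 'I_m -> 'I_K -> S) :
  \sum_r \prod_p G p (tnth (multiidx r) p) = \prod_p \sum_k G p k.
Proof.
rewrite bigA_distr_bigA /=.
pose h (r : 'I_(K ^ m)) : {ffun 'I_m -> 'I_K} := [ffun p => tnth (multiidx r) p].
have h_bij : bijective h.
  apply: inj_card_bij; last by rewrite card_ffun !card_ord.
  move=> r s /ffunP hrs; apply: (@multiidx_inj K m); apply: eq_from_tnth => p.
  by have := hrs p; rewrite !ffunE.
rewrite (reindex h) /=; last exact: onW_bij.
by apply: eq_bigr => r _; apply: eq_bigr => p _; rewrite ffunE.
Qed.

(** The inner product of two pure tensors is the product of the inner products of
their factors. *)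
Lemma mul_khatri_rao_prod (S : comNzRingType) (K n n' m : nat)
    (A : 'I_m -> 'M[S]_(K, n)) (B : 'I_m -> 'M[S]_(K, n')) i j :
  ((khatri_rao_prod A)^T *m khatri_rao_prod B) i j
    = \prod_p ((A p)^T *m B p) i j.
Proof.
rewrite mxE; under [LHS]eq_bigr do rewrite mxE !khatri_rao_prodE -big_split.
rewrite (sum_multiidx (fun p k => A p k i * B p k j)).
by apply: eq_bigr => p _; rewrite !mxE; apply: eq_bigr => k _; rewrite mxE.
Qed.

(** Expanding the permanent exhibits the columns of [calR m C] as sums of pure
tensors, so that [mul_khatri_rao_prod] applies to them. *)
Lemma calR_sum (S : comNzRingType) (m K R : nat) (C : 'M[S]_(K, R)) :
  calR m C = \sum_(s : 'S_m)
    khatri_rao_prod (fun p => colsub (fun j => tnth (incridx j) (s p)) C).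
Proof.
apply/matrixP => r j; rewrite !mxE summxE; apply: eq_bigr => s _.
by rewrite khatri_rao_prodE; apply: eq_bigr => p _; rewrite !mxE.
Qed.

(** Evaluation of a product of linear forms at the columns of X: against a power
of one vector, the m! reorderings of the factors all contribute equally. *)
Lemma mul_khatri_rao_exp_calR (S : comNzRingType) (m K R n : nat)
    (C : 'M[S]_(K, R)) (X : 'M[S]_(K, n)) i j :
  ((khatri_rao_exp m X)^T *m calR m C) i j
    = (m`!)%:R * \prod_(p < m) (X^T *m C) i (tnth (incridx j) p).
Proof.
rewrite calR_sum mulmx_sumr summxE.
rewrite (eq_bigr (fun=> \prod_(p < m) (X^T *m C) i (tnth (incridx j) p))).
  by rewrite sumr_const card_Sn mulr_natl.
move=> s _; rewrite mul_khatri_rao_prod [RHS](reindex_perm s) /=.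
by apply: eq_bigr => p _; rewrite !mxE; apply: eq_bigr => k _; rewrite !mxE.
Qed.

(** * Increasing index tuples *)

Lemma incridx_sorted (R m : nat) (j : 'I_('C(R, m))) :
  sorted ltn (map val (incridx j)).
Proof.
by have := Order.enum_valP (cast_ord (esym (card_incr_tuples m R)) j); rewrite inE.
Qed.

Lemma incridx_uniq (R m : nat) (j : 'I_('C(R, m))) : uniq (incridx j).
Proof.
by rewrite -(map_inj_uniq val_inj) (sorted_uniq ltn_trans ltnn) ?incridx_sorted.
Qed.

Lemma incridx_inj (R m : nat) : injective (@incridx R m).
Proof.
move=> i j eq_ij; apply: (@cast_ord_inj _ _ (esym (card_incr_tuples m R))).
exact: (@Order.enum_val_inj _ _ (pred_of_set (incr_tuples m R))) eq_ij.
Qed.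

(** Two increasing tuples of equal length with nested supports coincide. *)
Lemma incridx_subset (R m : nat) (i j : 'I_('C(R, m))) :
  {subset incridx i <= incridx j} -> i = j.
Proof.
move=> sij; apply: incridx_inj; apply: val_inj => /=.
have [|_ eq_ij] := uniq_min_size (incridx_uniq i) sij; first by rewrite !size_tuple.
apply: (inj_map val_inj).
apply: (irr_sorted_eq ltn_trans ltnn); rewrite ?incridx_sorted //.
by move=> x; apply/mapP/mapP => -[y yi ->]; exists y; rewrite // ?eq_ij // -eq_ij.
Qed.

Lemma incridx_neq (R m : nat) (i j : 'I_('C(R, m))) :
  i != j -> exists p, tnth (incridx i) p \notin incridx j.
Proof.
move=> nij; have /allPn[x] : ~~ all (mem (incridx j)) (incridx i).
  by apply: contraNN nij => /allP/incridx_subset ->.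
by case/tnthP=> p ->; exists p.
Qed.

Lemma card_setC_incridx (R m : nat) (j : 'I_('C(R, m))) :
  #|[set i | i \notin incridx j]| = (R - m)%N.
Proof.
have -> : [set i | i \notin incridx j] = ~: [set i in incridx j].
  by apply/setP => i; rewrite !inE.
by rewrite cardsCs setCK card_ord cardsE (card_uniqP (incridx_uniq j)) size_tuple.
Qed.

(** * Linear independence and points of prescribed vanishing *)

(** The k-rank only speaks of sets of exactly [krank M] columns; a smaller family is
enlarged to such a set, and inherits its freeness. *)
Lemma krank_free (F : fieldType) (p q : nat) (M : 'M[F]_(p, q)) (s : seq 'I_q) :
  uniq s -> (size s <= krank M)%N -> free [seq col j M | j <- s].
Proof.
move=> uniq_s size_s.
pose P (k : 'I_q.+1) := [forall J : {set 'I_q}, (#|J| == k) ==>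
  free [seq col j M | j <- enum J]].
have [k [le_sk le_kq kP]] : exists k, [/\ (size s <= k)%N, (k <= q)%N &
    forall J : {set 'I_q}, #|J| = k -> free [seq col j M | j <- enum J]].
  have P0 : P ord0.
    apply/'forall_implyP => J; rewrite cards_eq0 => /eqP ->.
    by rewrite enum_set0 nil_free.
  have P_gt0 : (0 < #|P|)%N by apply/card_gt0P; exists ord0.
  have [k /'forall_implyP Pk kE] :=
    eq_bigmax_cond (fun k : 'I_q.+1 => k : nat) P_gt0.
  exists k; split; last by move=> J /eqP/Pk.
    by rewrite -kE.
  by rewrite -ltnS.
(* t enlarges s by arbitrary indices outside s up to the size k. *)
pose t := s ++ take (k - size s) [seq i <- enum 'I_q | i \notin s].
have uniq_t : uniq t.
  have -> : uniq t = ~~ has (mem s)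
      (take (k - size s) [seq i <- enum 'I_q | i \notin s]).
    by rewrite cat_uniq uniq_s take_uniq ?andbT // filter_uniq // fintype.enum_uniq.
  by apply/hasPn => i /mem_take; rewrite mem_filter => /andP[].
have size_t : size t = k.
  rewrite size_cat size_take_min (minn_idPl _) ?subnKC //.
  rewrite -(leq_add2l (size s)) subnKC //; apply: leq_trans le_kq _.
  rewrite size_filter -[leqLHS](size_enum_ord q) -(count_predC (mem s)) leq_add2r.
  rewrite -size_filter; apply: uniq_leq_size.
    by rewrite filter_uniq ?fintype.enum_uniq.
  by move=> i; rewrite mem_filter => /andP[].
have enum_t : perm_eq (enum [set i in t]) t.
  apply: uniq_perm; [exact: fintype.enum_uniq | exact: uniq_t |].
  by move=> i; rewrite mem_enum inE.
have: free [seq col j M | j <- t].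
  rewrite -(perm_free (perm_map _ enum_t)).
  by apply: kP; rewrite cardsE (card_uniqP uniq_t).
by rewrite map_cat => /catl_free.
Qed.

Lemma mxrank_colsub_krank (F : fieldType) (p q n : nat) (M : 'M[F]_(p, q))
    (h : 'I_n -> 'I_q) :
  injective h -> (n <= krank M)%N -> \rank (colsub h M) = n.
Proof.
move=> h_inj le_nk.
have: free [seq col j M | j <- [tuple h i | i < n]].
  by apply: krank_free; rewrite ?size_tuple // map_inj_uniq ?fintype.enum_uniq.
move/freeP => /= freeP.
rewrite -mxrank_tr; apply/eqP/inj_row_free => v vM0.
apply/rowP => i; rewrite mxE; apply: freeP i.
apply/colP => k; rewrite summxE mxE.
move/rowP/(_ k): vM0; rewrite !mxE => {2}<-; apply: eq_bigr => i _.
have lt_in : (i < size (enum 'I_n))%N by rewrite size_enum_ord.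
rewrite (nth_map (h i)); last by rewrite size_map.
rewrite (nth_map i) //.
by rewrite nth_ord_enum !mxE.
Qed.

(** A nonzero polynomial cannot vanish at more naturals than its size; apply this
to the product of the family. *)
Lemma exists_common_nonroot (F : numDomainType) (I : finType) (A : {pred I})
    (P : I -> {poly F}) :
  (forall i, i \in A -> P i != 0) -> exists t, forall i, i \in A -> (P i).[t] != 0.
Proof.
move=> P0; pose Q := \prod_(i in A) P i.
have Q0 : Q != 0 by apply/prodf_neq0.
pose rs : seq F := [seq n%:R | n <- iota 0 (size Q)].
have /allPn[t _ Qt] : ~~ all (root Q) rs.
  apply: contraNN Q0 => allQ; apply/eqP; apply: roots_geq_poly_eq0 allQ _ _.
    rewrite map_inj_uniq ?iota_uniq //; exact: (mulrIn (oner_neq0 F)).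
  by rewrite size_map size_iota.
exists t => i Ai; apply: contraNneq Qt => Pt0.
by rewrite rootE /Q horner_prod (bigD1 i) //= Pt0 mul0r.
Qed.

(** For each i outside S, independence of the columns in S and of column i gives a
vector y_i orthogonal to the former and with inner product 1 with the latter.
The combination of the y_i with coefficients t^i is orthogonal to the columns in
S; its inner product with column j outside S is a polynomial in t whose
coefficient of degree j is 1, so all but finitely many t are suitable. *)
Lemma exists_annihilator (F : numFieldType) (K R : nat) (C : 'M[F]_(K, R))
    (S : {set 'I_R}) :
  (#|S| < krank C)%N ->
  exists x : 'cV[F]_K, forall i, ((x^T *m C) 0 i == 0) = (i \in S).
Proof.
move=> ltSk.
have /fin_all_exists[y yP] : forall i : 'I_R, exists y : 'rV[F]_K, i \notin S ->
    (forall k, k \in S -> (y *m C) 0 k = 0) /\ (y *m C) 0 i = 1.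
  move=> i; have [iS|iNS] := boolP (i \in S); first by exists 0.
  pose t := in_tuple (i :: enum S).
  have uniq_t : uniq t by rewrite /= mem_enum iNS fintype.enum_uniq.
  have t_inj : injective (tnth t) by apply/tuple_uniqP.
  have rk_t : \rank (colsub (tnth t) C) = size (i :: enum S).
    by apply: mxrank_colsub_krank => //=; rewrite -cardE.
  have /row_fullP[B BE] : row_full (colsub (tnth t) C) by rewrite /row_full rk_t.
  exists (row ord0 B) => _.
  have yE k : (row ord0 B *m C) 0 (tnth t k) = (ord0 == k)%:R.
    have /rowP/(_ k) := congr1 (row ord0) BE; rewrite row_mul !mxE => <-.
    by apply: eq_bigr => l _; rewrite !mxE.
  split; last by have := yE ord0; rewrite (tnth_nth i).
  move=> k kS; have : k \in t by rewrite inE mem_enum kS orbT.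
  case/tnthP => l kE; rewrite kE yE; case: eqP => // l0.
  by case/negP: iNS; move: kS; rewrite kE -l0 (tnth_nth i).
pose P i : {poly F} := \sum_(k | k \notin S) ((y k *m C) 0 i)%:P * 'X^k.
have [i /= iNS|t Pt] := @exists_common_nonroot _ _ [pred i | i \notin S] P.
  suff : (P i)`_i != 0 by apply: contraNneq => ->; rewrite coef0 eqxx.
  rewrite coef_sum (bigD1 i) //= coefCM coefXn eqxx (yP i iNS).2 mulr1.
  rewrite big1 ?addr0 ?oner_eq0 //.
  move=> k /andP[_ ki]; rewrite coefCM coefXn.
  by rewrite eq_sym (inj_eq val_inj) (negPf ki) mulr0.
exists (\sum_(k | k \notin S) t ^+ k *: y k)^T => i.
have -> : (((\sum_(k | k \notin S) t ^+ k *: y k)^T)^T *m C) 0 i = (P i).[t].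
  rewrite trmxK mulmx_suml summxE horner_sum; apply: eq_bigr => k _.
  by rewrite hornerM hornerC hornerXn -scalemxAl mxE mulrC.
have [iS|iNS] := boolP (i \in S); last exact/negbTE/Pt.
by rewrite horner_sum big1 ?eqxx // => k kNS; rewrite !hornerE (yP k kNS).1 ?mul0r.
Qed.

(** For each increasing tuple J, the test point is a vector orthogonal to exactly
the columns of C outside J. *)
Lemma mxrank_calR (F : numFieldType) (m K R : nat) (C : 'M[F]_(K, R)) :
  (R - m < krank C)%N -> \rank (calR m C) = 'C(R, m).
Proof.
move=> lt_k.
have /fin_all_exists[x xP] : forall j : 'I_('C(R, m)), exists x : 'cV[F]_K,
    forall i, ((x^T *m C) 0 i == 0) = (i \notin incridx j).
  move=> j; have [|x xP] := @exists_annihilator _ _ _ C [set i | i \notin incridx j].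
    by rewrite card_setC_incridx.
  by exists x => i; rewrite xP inE.
pose X := \matrix_(k, j) x j k 0.
have XE i l : (X^T *m C) i l = ((x i)^T *m C) 0 l.
  by rewrite !mxE; apply: eq_bigr => k _; rewrite !mxE.
have m0 := fact_neq0 F m.
apply: (mxrank_diag_test (D := (khatri_rao_exp m X)^T)).
  apply/is_diag_mxP => i j; rewrite val_eqE => nij.
  rewrite mul_khatri_rao_exp_calR.
  have [p pP] : exists p, tnth (incridx j) p \notin incridx i.
    by apply: incridx_neq; rewrite eq_sym.
  have /eqP XC0 : (X^T *m C) i (tnth (incridx j) p) == 0 by rewrite XE xP.
  by rewrite (bigD1 p) //= XC0 mul0r mulr0.
move=> j; rewrite mul_khatri_rao_exp_calR mulf_neq0 //.
by apply/prodf_neq0 => p _; rewrite XE xP negbK mem_tnth.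
Qed.

(** * Symmetric tensors *)

Lemma calR_perm_row (S : comNzRingType) (m K R : nat)
    (C : 'M[S]_(K, R)) (l : 'S_m) r s j :
  multiidx r = [tuple tnth (multiidx s) (l p) | p < m] ->
  calR m C r j = calR m C s j.
Proof.
move=> rE; rewrite !mxE /permanent (reindex_inj (mulgI l)) /=.
apply: eq_bigr => t _; rewrite [RHS](reindex_perm l) /=.
by apply: eq_bigr => p _; rewrite !mxE rE tnth_mktuple permM.
Qed.

(** By [calR_perm_row], symmetrization averages m! equal rows of [calR m C]. *)
Lemma calR_symmetrizer (F : numFieldType) (m K R : nat) (C : 'M[F]_(K, R)) :
  (calR m C)^T *m symmetrizer_mx F K m = (calR m C)^T.
Proof.
have m0 := fact_neq0 F m.
have [f fK Kf] := multiidx_bij K m.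
apply/matrixP => j s; rewrite mxE.
under eq_bigr => r _ do rewrite [_^T _ _]mxE [X in _ * X]mxE mulrCA mulr_sumr.
rewrite -mulr_sumr exchange_big /=.
rewrite (eq_bigr (fun=> calR m C s j)) => [|l _].
  by rewrite sumr_const card_Sn -(mulr_natl (calR m C s j)) mulKf // [RHS]mxE.
pose r0 := f [tuple tnth (multiidx s) (l p) | p < m].
rewrite (bigD1 r0) //= Kf eqxx mulr1 big1 ?addr0 => [|r rN].
  by apply: (@calR_perm_row _ _ _ _ _ l); rewrite Kf.
case: eqP => [rE|]; last by rewrite mulr0.
by case/eqP: rN; apply: (@multiidx_inj K m); rewrite Kf.
Qed.

Lemma symmetrizer_khatri_rao_exp (F : numFieldType) (K n m : nat)
    (B : 'M[F]_(K, n)) :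
  symmetrizer_mx F K m *m khatri_rao_exp m B = khatri_rao_exp m B.
Proof.
have m0 := fact_neq0 F m.
suff fix_col j :
    symmetrizer_mx F K m *m col j (khatri_rao_exp m B) = col j (khatri_rao_exp m B).
  apply/matrixP => r j; have /colP/(_ r) := fix_col j.
  by rewrite colE mulmxA -!colE [LHS]mxE [RHS]mxE.
have -> : col j (khatri_rao_exp m B) = khatri_rao_exp m (col j B).
  apply/colP => r; rewrite mxE !khatri_rao_prodE.
  by apply: eq_bigr => p _; rewrite mxE.
rewrite -mxfunE -[mxfun _]/(symmetrizer F K m) symmetrizer_khatri_rao_prod.
by rewrite sumr_const card_Sn -scaler_nat scalerA mulVf ?scale1r.
Qed.

(** The columns of the symmetrizer at s and at the sorted rearrangement of s are
equal, and distinct sorted tuples are not rearrangements of each other; so the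
columns at sorted tuples form a basis of the range, and sorted tuples are the
multisets of size m in a set of k + 1 elements. *)
Lemma mxrank_symmetrizer (F : numFieldType) (k m : nat) :
  \rank (symmetrizer_mx F k.+1 m) = 'C(m + k, m).
Proof.
have m0 := fact_neq0 F m.
have [f fK Kf] := multiidx_bij k.+1 m.
pose A := [set t : m.-tuple 'I_k.+1 | sorted leq (map val t)].
rewrite -(card_sorted_tuples m k) -/A.
pose g (i : 'I_#|A|) : 'I_(k.+1 ^ m) := f (enum_val i).
pose P := symmetrizer_mx F k.+1 m.
pose srt (t : m.-tuple 'I_k.+1) : m.-tuple 'I_k.+1 :=
  [tuple of sort (relpre val leq) t].
have srtA t : srt t \in A.
  rewrite inE /= sorted_map; apply: sort_sorted => x y; exact: leq_total.
have A_perm t t' : t \in A -> t' \in A -> perm_eq t t' -> t = t'.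
  rewrite !inE => tA t'A tt'; apply: val_inj; apply: (inj_map val_inj).
  by apply: (sorted_eq leq_trans anti_leq) => //; apply: perm_map.
have Pcol r s : P r s = P r (f (srt (multiidx s))).
  rewrite !mxE; congr (_ * _).
  have /tuple_permP[l lE] : perm_eq (srt (multiidx s)) (multiidx s).
    by rewrite perm_sort.
  (* A rearrangement of sorted s by t is one of s by t * l. *)
  rewrite [LHS](reindex_inj (mulIg l)) /=.
  apply: eq_bigr => t _; congr (_ == _)%:R; apply: eq_from_tnth => p.
  rewrite !tnth_mktuple Kf permM.
  have -> : srt (multiidx s) = [tuple tnth (multiidx s) (l p) | p < m].
    by apply: val_inj.
  by rewrite tnth_mktuple.
have Pg i j : P (g i) (g j) = (m`!)%:R^-1 *
    \sum_(l : 'S_m) (enum_val i == [tuple tnth (enum_val j) (l p) | p < m])%:R.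
  by rewrite mxE !Kf.
have PE : P = colsub g P *m \matrix_(i, s) (enum_val i == srt (multiidx s))%:R.
  apply/matrixP => r s; rewrite [RHS]mxE Pcol.
  rewrite (bigD1 (enum_rank_in (srtA (multiidx s)) (srt (multiidx s)))) //=.
  rewrite [colsub _ _ _ _]mxE [X in _ * X]mxE /g !enum_rankK_in // eqxx mulr1.
  rewrite big1 ?addr0 // => i iN.
  rewrite [X in _ * X]mxE; case: eqP => [iE|]; last by rewrite mulr0.
  by case/eqP: iN; apply: enum_val_inj; rewrite enum_rankK_in.
have rk_gP : \rank (colsub g P) = #|A|.
  apply: (mxrank_diag_test (D := rowsub g 1%:M)).
    apply/is_diag_mxP => i j; rewrite val_eqE => nij.
    rewrite mul_rowsub_mx mul1mx mxE [X in X = 0]mxE Pg big1 ?mulr0 // => l _.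
    case: eqP => // ijE; case/eqP: nij; apply: enum_val_inj.
    apply: A_perm; rewrite ?enum_valP //; apply/tuple_permP; exists l.
    by rewrite {1}ijE.
  move=> j; rewrite mul_rowsub_mx mul1mx mxE [X in X != 0]mxE Pg.
  rewrite mulf_neq0 ?invr_eq0 // -natr_sum pnatr_eq0 -lt0n.
  rewrite (bigD1 1%g) //= (_ : _ == _) //.
  by apply/eqP/eq_from_tnth => p; rewrite tnth_mktuple perm1.
apply/eqP; rewrite eqn_leq; apply/andP; split.
  by rewrite -/P PE -[leqRHS]rk_gP mxrankM_maxl.
rewrite -[leqLHS]rk_gP -/P.
have -> : colsub g P = P *m colsub g 1%:M by rewrite mulmx_colsub mulmx1.
exact: mxrankM_maxl.
Qed.

(** * Generalized cross products of columns *)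

(** Among the n-subsets of an (n + 1)-set, the lexicographic order is the
decreasing order of the omitted element k: where the tuples omitting j < i first
differ, at position j, one has j + 1 and the other j.  Hence the l-th subset omits
n - l, which is what the antidiagonal shape of L expects. *)
Lemma incridx_corank1 (n : nat) (l : 'I_('C(n.+1, n))) (k : 'I_n.+1) :
  (l + k)%N = n -> incridx l = [tuple lift k p | p < n].
Proof.
move=> lk.
pose g (k : 'I_n.+1) : n.-tuplelexi 'I_n.+1 := [tuple lift k p | p < n].
have tg k' p : tnth (g k') p = lift k' p by rewrite tnth_mktuple.
have g_lt : {homo g : i j / (j < i)%N >-> (i < j)%O}.
  move=> i j ltji; apply/ltxi_tuplePlt.
  have jn : (j < n)%N by apply: leq_trans ltji _; rewrite -ltnS.
  exists (Ordinal jn) => [p /= ltpj|].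
    rewrite !tg; apply: val_inj; rewrite /= /bump.
    by rewrite leqNgt (ltn_trans ltpj ltji) leqNgt ltpj.
  by rewrite !tg ltEord /= /bump leqnn (leqNgt i) ltji.
have gA k' : g k' \in incr_tuples n n.+1.
  rewrite inE /= -map_comp.
  have -> : map (val \o lift k') (enum 'I_n) = map (bump k') (iota 0 n).
    by rewrite -val_enum_ord -map_comp.
  rewrite sorted_map; apply: sub_sorted (iota_ltn_sorted 0 n) => x y /=.
  by rewrite !ltnNge leq_bump2.
pose A := pred_of_set (incr_tuples n n.+1).
pose L := map g (rev (enum 'I_n.+1)).
have L_sorted : sorted <%O L.
  rewrite sorted_map rev_sorted.
  apply: (sub_sorted (e := relpre val ltn)) => [x y /= /g_lt //|].
  by rewrite -sorted_map val_enum_ord iota_ltn_sorted.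
have A_sorted : sorted <%O (Order.enum A).
  by rewrite sort_lt_sorted fintype.enum_uniq.
have LE : Order.enum A = L.
  apply: lt_sorted_eq => // t; apply/esym.
  have sLA : {subset L <= Order.enum A}.
    by move=> x /mapP[k' _ ->]; rewrite Order.mem_enum gA.
  have L_uniq : uniq L by apply: lt_sorted_uniq.
  have [|_ ->//] := uniq_min_size L_uniq sLA.
  rewrite -Order.cardE card_incr_tuples binSn.
  by rewrite size_map size_rev fintype.size_enum_ord.
rewrite /incridx (Order.enum_val_nth (g k)) -/A LE /=.
have ltl : (l < n.+1)%N by rewrite ltnS; have := leq_addr k l; rewrite lk.
have nl : (n - l)%N = k by rewrite -[X in (X - _)%N]lk addKn.
rewrite (nth_map k) ?size_rev ?fintype.size_enum_ord //.
rewrite nth_rev ?fintype.size_enum_ord //.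
by rewrite subSS nl fintype.nth_ord_enum.
Qed.

Lemma calBE (S : comNzRingType) (n R : nat) (C : 'M[S]_(n.+1, R)) k j :
  calB C k j = (-1) ^+ (n - k) * \det (mxsub (lift k) (tnth (incridx j)) C).
Proof.
have lt_l : (n - k < 'C(n.+1, n))%N by rewrite binSn ltnS leq_subr.
have lk : (Ordinal lt_l + k)%N = n by rewrite /= subnK // -ltnS.
rewrite mxE (bigD1 (Ordinal lt_l)) //= big1 ?addr0 => [|l lN].
  rewrite !mxE addnC lk eqxx; congr (_ * \det _).
  by apply/matrixP => p q; rewrite !mxE (incridx_corank1 lk) tnth_mktuple.
rewrite mxE; case: eqP => [kl|]; last by rewrite mul0r.
case/eqP: lN; apply: val_inj => /=.
by rewrite -[X in (X - _)%N]kl addKn.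
Qed.

(** Laplace expansion along the last column.  The signs agree because n - k and
k + n have the same parity. *)
Lemma mul_calB (S : comNzRingType) (n R : nat) (C : 'M[S]_(n.+1, R)) i j :
  ((calB C)^T *m C) j i
    = \det (colsub (fun q => oapp (tnth (incridx j)) i (unlift ord_max q)) C).
Proof.
rewrite (expand_det_col _ ord_max) mxE; apply: eq_bigr => k _.
rewrite [_^T _ _]mxE calBE mxE unlift_none mulrC; congr (_ * _).
rewrite /cofactor; congr (_ * _); last congr (\det _).
  have kn : (k <= n)%N by rewrite -ltnS.
  by rewrite /= -signr_odd -[RHS]signr_odd oddD oddB // addbC.
by apply/matrixP => p q; rewrite !mxE liftK.
Qed.

Lemma mul_calB_eq0 (S : comNzRingType) (n R : nat) (C : 'M[S]_(n.+1, R)) i j :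
  i \in incridx j -> ((calB C)^T *m C) j i = 0.
Proof.
case/tnthP => p ->; rewrite mul_calB -det_tr.
have: lift ord_max p != ord_max by rewrite eq_sym neq_lift.
move/determinant_alternate; apply=> k.
by rewrite !mxE unlift_none liftK.
Qed.

Lemma mul_calB_neq0 (F : fieldType) (n R : nat) (C : 'M[F]_(n.+1, R)) i j :
  (n < krank C)%N -> i \notin incridx j -> ((calB C)^T *m C) j i != 0.
Proof.
move=> lt_nk iNj; rewrite mul_calB.
set h := (h in colsub h C).
have h_inj : injective h.
  move=> q q'; rewrite /h.
  case: unliftP => [p ->|->]; case: unliftP => [p' ->|->] //=.
  - by move/(tuple_uniqP (incridx j) (incridx_uniq j)) ->.
  - by move=> jp; case/negP: iNj; rewrite -jp mem_tnth.
  - by move=> jp; case/negP: iNj; rewrite jp mem_tnth.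
by rewrite -unitfE -unitmxE -row_free_unit /row_free (mxrank_colsub_krank h_inj).
Qed.

(** An m-set and an n-set of indices below R < m + n meet, and a common index
gives a vanishing factor. *)
Lemma khatri_rao_exp_calB_calR (S : comNzRingType) (n R m : nat)
    (C : 'M[S]_(n.+1, R)) :
  (R < m + n)%N -> (calR m C)^T *m khatri_rao_exp m (calB C) = 0.
Proof.
move=> ltR; apply: trmx_inj; rewrite trmx_mul trmxK trmx0.
apply/matrixP => j i; rewrite mul_khatri_rao_exp_calR [RHS]mxE.
have [p pj] : exists p, tnth (incridx i) p \in incridx j.
  apply/existsP; apply: contraLR ltR; rewrite negb_exists -leqNgt => /forallP disj.
  have : uniq (incridx i ++ incridx j).
    rewrite cat_uniq !incridx_uniq andbT /=; apply/hasPn => x xj.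
    by apply/negP => /tnthP[p xE]; move: (disj p); rewrite -xE xj.
  move/card_uniqP; rewrite size_cat !size_tuple => <-.
  by rewrite -[leqRHS]card_ord max_card.
by rewrite (bigD1 p) //= mul_calB_eq0 // mul0r mulr0.
Qed.

(** The power attached to J is tested against a pure tensor whose factors are the
columns c_i with i outside J, each occurring at least once.  There are only R - n
of them, so when m exceeds R - n some factor is repeated; this does not change
where the product vanishes. *)
Lemma mxrank_khatri_rao_exp_calB (F : fieldType) (n R m : nat)
    (C : 'M[F]_(n.+1, R)) :
  (n < krank C)%N -> (n < R)%N -> (R - n <= m)%N ->
  \rank (khatri_rao_exp m (calB C)) = 'C(R, n).
Proof.
move=> lt_nk lt_nR le_m.
have /fin_all_exists[f fP] : forall j : 'I_('C(R, n)), exists f : 'I_m -> 'I_R,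
    (forall p, f p \notin incridx j) /\
    (forall i, i \notin incridx j -> exists p, f p = i).
  move=> j; pose S := [set i | i \notin incridx j].
  have cardS : #|S| = (R - n)%N by apply: card_setC_incridx.
  have /card_gt0P[d dS] : (0 < #|S|)%N by rewrite cardS subn_gt0.
  (* The default d of nth, itself outside J, fills the excess positions. *)
  exists (fun p => nth d (enum S) p); split=> [p|i iNj].
    have : nth d (enum S) p \in S.
      have [ltp|lep] := ltnP p (size (enum S)); last by rewrite nth_default.
      by rewrite -mem_enum mem_nth.
    by rewrite inE.
  have iS : i \in enum S by rewrite mem_enum inE.
  have lt_i : (index i (enum S) < m)%N.
    by apply: leq_trans le_m; rewrite -cardS cardE index_mem.
  by exists (Ordinal lt_i); rewrite /= nth_index.
pose T p := colsub (fun j => f j p) C.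
have TE i j : ((khatri_rao_prod T)^T *m khatri_rao_exp m (calB C)) i j
    = \prod_p ((calB C)^T *m C) j (f i p).
  rewrite mul_khatri_rao_prod; apply: eq_bigr => p _.
  by rewrite !mxE; apply: eq_bigr => k _; rewrite !mxE mulrC.
apply: (mxrank_diag_test (D := (khatri_rao_prod T)^T)).
  apply/is_diag_mxP => i j; rewrite val_eqE => nij; rewrite TE.
  have [q qN] : exists q, tnth (incridx j) q \notin incridx i.
    by apply: incridx_neq; rewrite eq_sym.
  have [p fpE] := (fP i).2 _ qN.
  by rewrite (bigD1 p) //= fpE mul_calB_eq0 ?mem_tnth // mul0r.
by move=> j; rewrite TE; apply/prodf_neq0 => p _; rewrite mul_calB_neq0 // (fP j).1.
Qed.

(** * Column rank, kernel dimension and kernel *)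

Theorem proposition2p13 (F : realType) (K R m : nat) (C : 'M[F]_(K, R))
    (hK : (2 <= K)%N) (hKR : (K <= R)%N) (hm : m = (R - K + 2)%N)
    (hC : (K.-1 <= krank C)%N) :
  [/\ \rank (calR m C) = 'C(R, m)
      /\ \dim (mxrange (calR m C)^T) = 'C(R, m),
      \dim (lker_restr (mxfun (calR m C)^T) (limg (symmetrizer F K m)))
        = 'C(R, K.-1)
    & krank C = K ->
      lker_restr (mxfun (calR m C)^T) (limg (symmetrizer F K m))
        = mxrange (khatri_rao_exp m (calB C))].
Proof.
case: K C hK hKR hm hC => // n C hK hKR hm hC; rewrite /= in hC.
have mE : m = (R - n).+1 by rewrite hm addn2 subnS prednK // subn_gt0.
have le_nR : (n <= R)%N := ltnW hKR.
have mn : (m + n)%N = R.+1 by rewrite mE addSn subnK.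
have rankR : \rank (calR m C) = 'C(R, m).
  have n_gt0 : (0 < n)%N by rewrite -ltnS.
  have le_mR : (m <= R)%N by rewrite -ltnS -mn -[X in (X < _)%N]addn0 ltn_add2l.
  by apply: mxrank_calR; apply: leq_trans hC; rewrite ltn_subLR // mn.
have dim_rangeR : \dim (mxrange (calR m C)^T) = 'C(R, m).
  by rewrite dim_mxrange mxrank_tr.
have dim_ker : \dim (lker_restr (mxfun (calR m C)^T)
    (limg (symmetrizer F n.+1 m))) = 'C(R, n).
  have := limg_ker_dim (mxfun (calR m C)^T) (limg (symmetrizer F n.+1 m)).
  rewrite -limg_comp.
  have -> : (mxfun (calR m C)^T \o symmetrizer F n.+1 m)%VF = mxfun (calR m C)^T.
    by apply/lfunP => v; rewrite comp_lfunE !mxfunE mulmxA calR_symmetrizer.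
  rewrite -/(mxrange _) -/(lker_restr _ _) dim_rangeR.
  rewrite [in RHS]dim_mxrange mxrank_symmetrizer.
  rewrite mn mE binS -mE -(bin_sub le_nR) => /eqP.
  by rewrite addnC eqn_add2l => /eqP.
split=> // krankK; apply/esym/eqP; rewrite eqEdim dim_ker dim_mxrange.
have le_Rn_m : (R - n <= m)%N by rewrite mE.
rewrite mxrank_khatri_rao_exp_calB ?krankK // leqnn andbT.
apply/subvP => v /memv_imgP[u _ ->].
rewrite memv_cap memv_ker !mxfunE mulmxA.
rewrite khatri_rao_exp_calB_calR ?mul0mx ?eqxx ?andbT.
  rewrite -symmetrizer_khatri_rao_exp -mulmxA -mxfunE -[mxfun _]/(symmetrizer _ _ _).
  by rewrite memv_img ?memvf.
by rewrite mn.
Qed.
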